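(* Let $A$ be a unital, simple, purely infinite C*-algebra. Suppose that there exist $n \in \mathbb{N}$ and non-trivial projections $p,q \in A$ such that $n[p]_0 = n[q]_0$ but $[p]_0 \neq [q]_0$ in $K_0(A)$. Then $p^{(n)}$ and $q^{(n)}$ are unitarily equivalent in $M_n(A)$, but $p$ and $q$ are not unitarily equivalent in $A$.
   Context: $\mathbb{N}=\{1,2,\dots\}$. A projection is non-trivial if it is neither $0$ nor the unit. A projection is infinite if it is Murray–von Neumann equivalent to a proper subprojection of itself; a simple C*-algebra is purely infinite if every nonzero hereditary C*-subalgebra contains an infinite projection. $[p]_0$ is the class of $p$ in $K_0(A)$. Elements $x,y$ of a unital C*-algebra $B$ are unitarily equivalent in $B$ if $u^*xu=y$ for some unitary $u\in B$. For $a\in A$, $a^{(n)} \in M_n(A)$ is the $n$-fold direct sum of $a$ with itself. *)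

(* Defs.v *)
From HB Require Import structures.
From mathcomp Require Import all_boot all_order all_algebra.
From mathcomp Require Import boolp classical_sets reals.
From mathcomp Require Import complex.

Set Implicit Arguments.
Unset Strict Implicit.
Unset Printing Implicit Defensive.

Import Order.TTheory GRing.Theory Num.Theory.

Local Open Scope classical_set_scope.
Local Open Scope quotient_scope.
Local Open Scope complex_scope.
Local Open Scope ring_scope.

(* Unitaries, projections, Murray-von Neumann equivalence and the matrix       *)
(* picture of K_0 only involve the *-ring structure, so they are set up for    *)
(* *-rings; this covers a C*-algebra A and M_n(A) at once.                     *)
HB.mixin Record PzRing_isStarRing A & GRing.PzRing A := {
  star : A -> A ;
  starD : {morph star : x y / x + y} ;
  starM : forall x y, star (x * y) = star y * star x ;
  starK : involutive star
}.

#[short(type="starRingType")]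
HB.structure Definition StarRing := { A of GRing.PzRing A & PzRing_isStarRing A }.

Section StarRingTheory.
Context {A : starRingType}.
Implicit Types x y p q u : A.

Lemma star0 : star (0 : A) = 0.
Proof. by apply: (addrI (star 0)); rewrite -starD !addr0. Qed.

Lemma star1 : star (1 : A) = 1.
Proof. by rewrite -[LHS]mulr1 -[X in _ * X]starK -starM mulr1 starK. Qed.

Lemma star_sum I (r : seq I) (P : pred I) (F : I -> A) :
  star (\sum_(i <- r | P i) F i) = \sum_(i <- r | P i) star (F i).
Proof. exact: (big_morph _ starD star0). Qed.

Definition unitary u := star u * u = 1 /\ u * star u = 1.

Definition unitarily_equivalent x y := exists2 u, unitary u & star u * x * u = y.

Definition projection p : bool := (p * p == p) && (star p == p).

Definition subprojection q p := projection q /\ p * q = q.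

Definition MvN_equiv p q := exists v : A, star v * v = p /\ v * star v = q.

Definition infinite_projection p :=
  projection p /\ exists q, [/\ subprojection q p, q <> p & MvN_equiv p q].

End StarRingTheory.

Section MatrixStar.
Context {A : starRingType}.

Definition mxstar m n (M : 'M[A]_(m, n)) : 'M[A]_(n, m) := (map_mx star M)^T.

Lemma mxstarD m n : {morph @mxstar m n : M N / M + N}.
Proof. by move=> M N; apply/matrixP=> i j; rewrite !mxE starD. Qed.

Lemma mxstarM m n p (M : 'M[A]_(m, n)) (N : 'M[A]_(n, p)) :
  mxstar (M *m N) = mxstar N *m mxstar M.
Proof.
apply/matrixP=> i j; rewrite !mxE star_sum; apply: eq_bigr => k _.
by rewrite !mxE starM.
Qed.

Lemma mxstarK m n (M : 'M[A]_(m, n)) : mxstar (mxstar M) = M.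
Proof. by apply/matrixP=> i j; rewrite !mxE starK. Qed.

HB.instance Definition _ n :=
  PzRing_isStarRing.Build 'M[A]_n (@mxstarD n n) (@mxstarM n n n) (@mxstarK n n).

Lemma mxstar_block m1 m2 n1 n2 (a : 'M[A]_(m1, n1)) (b : 'M[A]_(m1, n2))
    (c : 'M[A]_(m2, n1)) (d : 'M[A]_(m2, n2)) :
  mxstar (block_mx a b c d) =
  block_mx (mxstar a) (mxstar c) (mxstar b) (mxstar d).
Proof. by rewrite /mxstar map_block_mx tr_block_mx. Qed.

Lemma mxstar0 m n : mxstar (0 : 'M[A]_(m, n)) = 0.
Proof. by apply/matrixP=> i j; rewrite !mxE star0. Qed.

Lemma projection_dsum m n (p : 'M[A]_m) (q : 'M[A]_n) :
  projection p -> projection q -> projection (block_mx p 0 0 q).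
Proof.
move=> /andP[/eqP pp /eqP sp] /andP[/eqP qq /eqP sq].
apply/andP; split; apply/eqP.
  rewrite /GRing.mul /= mulmx_block !mulmx0 !mul0mx !addr0 !add0r.
  by congr block_mx.
by rewrite /star /= mxstar_block !mxstar0; congr block_mx.
Qed.

Lemma projection0 n : projection (0 : 'M[A]_n).
Proof. by rewrite /projection mulr0 star0 !eqxx. Qed.

Lemma projection_scalar1 (p : A) : projection p -> projection (p%:M : 'M[A]_1).
Proof.
move=> /andP[/eqP pp /eqP sp]; apply/andP; split; apply/eqP.
  by rewrite -{3}pp; apply/matrixP=> i j; rewrite !ord1 !mxE big_ord1 !mxE eqxx.
by apply/matrixP=> i j; rewrite !ord1 !mxE eqxx.
Qed.

End MatrixStar.

(* P_oo(A): the disjoint union over n of the projections of M_n(A), with       *)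
(* direct sum and (rectangular) Murray-von Neumann equivalence.                *)
Section ProjectionSemigroup.
Variable A : starRingType.

Definition mxproj : Type := {n : nat & {p : 'M[A]_n | projection p}}.
HB.instance Definition _ := Choice.on mxproj.

Definition mxprojE (n : nat) (p : 'M[A]_n) (hp : projection p) : mxproj :=
  existT _ n (exist _ p hp).

Definition dim_mxproj (x : mxproj) : nat := projT1 x.
Definition val_mxproj (x : mxproj) : 'M[A]_(dim_mxproj x) := sval (projT2 x).

Definition dsum (x y : mxproj) : mxproj :=
  mxprojE (projection_dsum (svalP (projT2 x)) (svalP (projT2 y))).

Definition mxMvN_equiv (x y : mxproj) : Prop :=
  exists v : 'M[A]_(dim_mxproj y, dim_mxproj x),
    mxstar v *m v = val_mxproj x /\ v *m mxstar v = val_mxproj y.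

Lemma val_mxprojM x : val_mxproj x *m val_mxproj x = val_mxproj x.
Proof. by rewrite /val_mxproj; case: (projT2 x) => p /= /andP[/eqP]. Qed.

Lemma val_mxproj_star x : mxstar (val_mxproj x) = val_mxproj x.
Proof. by rewrite /val_mxproj; case: (projT2 x) => p /= /andP[_ /eqP]. Qed.

Lemma mxMvN_refl x : mxMvN_equiv x x.
Proof. by exists (val_mxproj x); rewrite val_mxproj_star val_mxprojM. Qed.

Lemma mxMvN_sym x y : mxMvN_equiv x y -> mxMvN_equiv y x.
Proof. by case=> v [vx vy]; exists (mxstar v); rewrite mxstarK. Qed.

(* u v is the composite of the partial isometries; u u^* u = u is not needed   *)
(* because the middle projection is idempotent.                                *)
Lemma mxMvN_trans y x z : mxMvN_equiv x y -> mxMvN_equiv y z -> mxMvN_equiv x z.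
Proof.
case=> v [vx vy] [w [wy wz]]; exists (w *m v); rewrite mxstarM; split.
  rewrite mulmxA -(mulmxA (mxstar v)) wy -vy mulmxA vx -mulmxA vx.
  exact: val_mxprojM.
rewrite mulmxA -(mulmxA w) vy -wy mulmxA wz -mulmxA wz.
exact: val_mxprojM.
Qed.

Definition mxMvN_equivb (x y : mxproj) : bool := `[< mxMvN_equiv x y >].

Lemma mxMvN_equivb_equiv : equiv_class_of mxMvN_equivb.
Proof.
split=> [x|x y|y x z]; first exact/asboolP/mxMvN_refl.
  by apply/asboolP/asboolP; apply: mxMvN_sym.
by move=> /asboolP xy /asboolP yz; apply/asboolP/(mxMvN_trans xy yz).
Qed.

Canonical mxMvN_equiv_rel := EquivRelPack mxMvN_equivb_equiv.

(* V(A) = P_oo(A) / ~                                                          *)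
Definition MvN_monoid := {eq_quot mxMvN_equivb}.
HB.instance Definition _ := Choice.on MvN_monoid.
HB.instance Definition _ := EqQuotient.on MvN_monoid.

Lemma MvN_piP (x y : mxproj) :
  \pi_MvN_monoid x = \pi_MvN_monoid y <-> mxMvN_equiv x y.
Proof. by split=> [/eqmodP/asboolP|xy] //; apply/eqmodP/asboolP. Qed.

Lemma dsum_equiv x x' y y' :
  mxMvN_equiv x x' -> mxMvN_equiv y y' -> mxMvN_equiv (dsum x y) (dsum x' y').
Proof.
case=> v [vx vx'] [w [wy wy']]; exists (block_mx v 0 0 w).
rewrite mxstar_block !mxstar0.
split; rewrite (mulmx_block (R := A)) !mulmx0 !mul0mx !addr0 !add0r;
  by [rewrite vx wy | rewrite vx' wy'].
Qed.

Lemma dsumC x y : mxMvN_equiv (dsum x y) (dsum y x).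
Proof.
exists (block_mx 0 (val_mxproj y) (val_mxproj x) 0).
rewrite mxstar_block !mxstar0 !val_mxproj_star.
by split; rewrite (mulmx_block (R := A)) !mulmx0 !mul0mx !addr0 !add0r
  !val_mxprojM.
Qed.

Lemma mxMvN_cast m n (e : m = n) (p : 'M[A]_m) (q : 'M[A]_n)
    (hp : projection p) (hq : projection q) :
  castmx (e, e) p = q -> mxMvN_equiv (mxprojE hp) (mxprojE hq).
Proof.
case: n / e in q hq *; rewrite castmx_id => pq; case: q / pq hq => hq.
by rewrite (bool_irrelevance hp hq); apply: mxMvN_refl.
Qed.

Lemma dsumA x y z : mxMvN_equiv (dsum x (dsum y z)) (dsum (dsum x y) z).
Proof.
apply: mxMvN_sym; apply: (mxMvN_cast (e := esym (addnA _ _ _))) => /=.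
have := block_mxA (A11 := val_mxproj x) (A12 := 0 :> 'M_(_, dim_mxproj y))
  (A13 := 0 :> 'M_(_, dim_mxproj z)) (A21 := 0) (A22 := val_mxproj y) (A23 := 0)
  (A31 := 0) (A32 := 0) (A33 := val_mxproj z).
by rewrite /= !row_mx0 !col_mx0 => /esym.
Qed.

Definition mxproj0 : mxproj := mxprojE (projection0 (A := A) 0).

Lemma dsum0 x : mxMvN_equiv (dsum mxproj0 x) x.
Proof.
have star_row : mxstar (row_mx 0 (val_mxproj x)) =
    col_mx (0 : 'M_(0, _)) (val_mxproj x).
  by rewrite /mxstar map_row_mx tr_row_mx -!/(mxstar _) mxstar0 val_mxproj_star.
exists (row_mx (0 : 'M_(_, 0)) (val_mxproj x)); rewrite star_row; split.
  by rewrite mul_col_row !mulmx0 !mul0mx val_mxprojM.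
by rewrite mul_row_col mul0mx add0r val_mxprojM.
Qed.

Definition MvN_add (u v : MvN_monoid) : MvN_monoid :=
  \pi_MvN_monoid (dsum (repr u) (repr v)).

Lemma MvN_addE x y : MvN_add (\pi_MvN_monoid x) (\pi_MvN_monoid y) =
  \pi_MvN_monoid (dsum x y).
Proof. by apply/MvN_piP/dsum_equiv; apply/MvN_piP; rewrite reprK. Qed.

Lemma MvN_addA : associative MvN_add.
Proof.
elim/quotW=> x; elim/quotW=> y; elim/quotW=> z.
rewrite (MvN_addE y z) (MvN_addE x y) !MvN_addE.
by apply/MvN_piP; apply: dsumA.
Qed.

Lemma MvN_addC : commutative MvN_add.
Proof. by move=> u v; apply/MvN_piP/dsumC. Qed.

Lemma MvN_add0 : left_id (\pi_MvN_monoid mxproj0) MvN_add.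
Proof. by elim/quotW=> x; rewrite MvN_addE; apply/MvN_piP/dsum0. Qed.

HB.instance Definition _ :=
  GRing.isNmodule.Build MvN_monoid MvN_addA MvN_addC MvN_add0.

End ProjectionSemigroup.

Section GrothendieckGroup.
Variable M : nmodType.

Definition groth_eq (x y : M * M) : bool :=
  `[< exists z : M, x.1 + y.2 + z = y.1 + x.2 + z >].

Lemma groth_eq_equiv : equiv_class_of groth_eq.
Proof.
split=> [x|x y|y x z]; first by apply/asboolP; exists 0.
  by apply/asboolP/asboolP => -[t e]; exists t.
move=> /asboolP[s es] /asboolP[t et]; apply/asboolP.
exists (y.1 + y.2 + s + t).
have -> : x.1 + z.2 + (y.1 + y.2 + s + t) =
    (x.1 + y.2 + s) + (y.1 + z.2 + t) by rewrite !addrA (ACl (1*4*5*3*2*6)).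
by rewrite es et !addrA (ACl (4*2*1*5*3*6)).
Qed.

Canonical groth_equiv_rel := EquivRelPack groth_eq_equiv.

Definition groth := {eq_quot groth_eq}.
HB.instance Definition _ := Choice.on groth.
HB.instance Definition _ := EqQuotient.on groth.

Lemma groth_piP (x y : M * M) :
  \pi_groth x = \pi_groth y <-> exists z : M, x.1 + y.2 + z = y.1 + x.2 + z.
Proof. by split=> [/eqmodP/asboolP|xy] //; apply/eqmodP/asboolP. Qed.

Definition groth_add (u v : groth) : groth :=
  \pi_groth ((repr u).1 + (repr v).1, (repr u).2 + (repr v).2).

Definition groth_opp (u : groth) : groth := \pi_groth ((repr u).2, (repr u).1).

Lemma groth_addE x y : groth_add (\pi_groth x) (\pi_groth y) =
  \pi_groth (x.1 + y.1, x.2 + y.2).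
Proof.
have [s es] : exists s : M, (repr (\pi_groth x)).1 + x.2 + s =
  x.1 + (repr (\pi_groth x)).2 + s by apply/groth_piP; rewrite reprK.
have [t et] : exists t : M, (repr (\pi_groth y)).1 + y.2 + t =
  y.1 + (repr (\pi_groth y)).2 + t by apply/groth_piP; rewrite reprK.
apply/groth_piP; exists (s + t) => /=.
by rewrite !addrA (ACl ((1*3*5)*(2*4*6))) /= es et !addrA (ACl (1*4*2*5*3*6)).
Qed.

Lemma groth_oppE x : groth_opp (\pi_groth x) = \pi_groth (x.2, x.1).
Proof.
have [s es] : exists s : M, (repr (\pi_groth x)).1 + x.2 + s =
  x.1 + (repr (\pi_groth x)).2 + s by apply/groth_piP; rewrite reprK.
apply/groth_piP; exists s => /=.
by rewrite [_ + x.1]addrC -es [x.2 + _]addrC.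
Qed.

Lemma groth_addA : associative groth_add.
Proof.
elim/quotW=> x; elim/quotW=> y; elim/quotW=> z.
rewrite (groth_addE y z) (groth_addE x y) !groth_addE /=.
by rewrite !addrA.
Qed.

Lemma groth_addC : commutative groth_add.
Proof.
elim/quotW=> x; elim/quotW=> y; rewrite !groth_addE.
by rewrite [x.1 + _]addrC [x.2 + _]addrC.
Qed.

Lemma groth_add0 : left_id (\pi_groth (0, 0)) groth_add.
Proof. by elim/quotW=> x; rewrite groth_addE !add0r -surjective_pairing. Qed.

Lemma groth_addN : left_inverse (\pi_groth (0, 0)) groth_opp groth_add.
Proof.
elim/quotW=> x; rewrite groth_oppE groth_addE; apply/groth_piP; exists 0.
by rewrite /= !addr0 add0r addrC.
Qed.

HB.instance Definition _ :=
  GRing.isZmodule.Build groth groth_addA groth_addC groth_add0 groth_addN.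

End GrothendieckGroup.

(* For unital A, K_0(A) is the Grothendieck group of V(A).                     *)
Definition K0 (A : starRingType) : zmodType := groth (MvN_monoid A).

Definition K0_class (A : starRingType) (p : A) (hp : projection p) : K0 A :=
  \pi_(groth (MvN_monoid A))
    (\pi_(MvN_monoid A) (mxprojE (projection_scalar1 hp)), 0).

(* The norm is a field of the structure, and not that of a                     *)
(* completeNormedModType R[i], because Hierarchy Builder rejects a join of     *)
(* GRing.Algebra and Num.NormedZmodule declared after Num.NumDomain, which     *)
(* inherits both semirings and normed Z-modules.                               *)
HB.mixin Record StarAlgebra_isCStarAlgebra (R : realType) A
    & GRing.Algebra R[i] A & StarRing A := {
  starZ : forall (c : R[i]) (x : A), star (c *: x) = c^* *: star x ;
  cnorm : A -> R ;
  cnormD : forall x y : A, cnorm (x + y) <= cnorm x + cnorm y ;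
  cnormZ : forall (c : R[i]) (x : A), (cnorm (c *: x))%:C = `|c| * (cnorm x)%:C ;
  cnorm0_eq0 : forall x : A, cnorm x = 0 -> x = 0 ;
  cnormM : forall x y : A, cnorm (x * y) <= cnorm x * cnorm y ;
  cnorm_starM : forall x : A, cnorm (star x * x) = cnorm x ^+ 2 ;
  cnorm_complete : forall u : nat -> A,
    (forall e : R, 0 < e -> exists N, forall m n, (N <= m)%N -> (N <= n)%N ->
      cnorm (u m - u n) < e) ->
    exists l : A, forall e : R, 0 < e -> exists N, forall n, (N <= n)%N ->
      cnorm (u n - l) < e
}.

#[short(type="cstarAlgType")]
HB.structure Definition CStarAlgebra (R : realType) :=
  { A of GRing.Algebra R[i] A & StarRing A & StarAlgebra_isCStarAlgebra R A }.

Section CStarAlgebraNotions.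
Context {R : realType} (A : cstarAlgType R).
Implicit Types a b x : A.

Definition invertible x := exists y, x * y = 1 /\ y * x = 1.

Definition spectrum a : set R[i] := [set z | ~ invertible (a - z%:A)].

(* The order on R[i] is the one for which [0 <= z] means that z is real and    *)
(* nonnegative.                                                                *)
Definition positive a := star a = a /\ forall z, spectrum a z -> 0 <= z.

Definition norm_closed (I : set A) := forall x,
  (forall e : R, 0 < e -> exists2 y, I y & cnorm (x - y) < e) -> I x.

Definition two_sided_ideal (I : set A) :=
  [/\ I 0, forall x y, I x -> I y -> I (x + y),
      forall a x, I x -> I (a * x) & forall a x, I x -> I (x * a)].

(* Nonzeroness of A is part of the structure.                                  *)
Definition simple_cstar := forall I : set A,
  two_sided_ideal I -> norm_closed I -> I = [set 0] \/ I = setT.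

(* C*-subalgebras need not contain the unit of A.                              *)
Definition cstar_subalgebra (B : set A) :=
  [/\ [/\ B 0, forall x y, B x -> B y -> B (x + y)
        & forall (c : R[i]) x, B x -> B (c *: x)],
      forall x y, B x -> B y -> B (x * y),
      forall x, B x -> B (star x) & norm_closed B].

Definition hereditary_subalgebra (B : set A) := cstar_subalgebra B /\
  forall a b, B b -> positive a -> positive (b - a) -> B a.

Definition purely_infinite := forall B : set A,
  hereditary_subalgebra B -> B <> [set 0] ->
  exists2 p, B p & infinite_projection p.

End CStarAlgebraNotions.

(* Main.v *)
Require Import Defs.
From HB Require Import structures.
From mathcomp Require Import all_boot all_order all_algebra.
From mathcomp Require Import boolp classical_sets reals.
From mathcomp Require Import complex.
From mathcomp Require Import ring lra.
From Stdlib Require Ncring Ncring_tac.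
Set Implicit Arguments.
Unset Strict Implicit.
Unset Printing Implicit Defensive.
Import Order.TTheory GRing.Theory Num.Theory.
Local Open Scope ring_scope.

(* Below any nonzero projection p there is a copy of the unit, so [p] = [1] + x in
   V(A), and applying this to p and 1 - p gives [1] = [1] + [1] + f. Any z is
   dominated by some k[1], hence x + z = y + z implies x = y for x = n[p], y = n[q];
   the same cancellation gives n[1-p] = n[1-q], and the two partial isometries add up
   to a unitary.

   The copy of the unit below p comes from an infinite projection r of pAp, with
   r ~ r0 < r: simplicity yields c_i with sum c_i^* (r - r0) c_i = 1, and r dominates
   arbitrarily many orthogonal copies of r - r0. That pAp is hereditary, and the
   normalisation of the c_i, rest on positivity in C*-algebras, for which no spectral
   theory is needed: call a self-adjoint a positive if |t - a| <= t for some real t;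
   square roots come from an iteration, and spectral positivity enters only as
   invertibility of a + s for s > 0. *)

(** * Normalisation of noncommutative ring identities *)

Section NoncommutativeRingTactic.
Variable A : pzRingType.

Definition pz_ring_ops :
  @Ncring.Ring_ops A 0 1 +%R *%R (fun x y => x - y) -%R eq :=
  @Ncring.Build_Ring_ops A 0 1 +%R *%R (fun x y => x - y) -%R eq.

Lemma pz_ring_Ring :
  @Ncring.Ring A 0 1 +%R *%R (fun x y => x - y) -%R eq pz_ring_ops.
Proof.
constructor; try exact _; try by move=> ? ? -> // ? ? ->.
all: first [ exact: add0r | exact: addrC | exact: addrA | exact: mul1r
  | exact: mulr1 | exact: mulrA | exact: mulrDl | by move=> *; exact: mulrDr
  | by [] | exact: subrr ].
Qed.

End NoncommutativeRingTactic.

Ltac ncring := Ncring_tac.non_commutative_ring.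

(** * Involution, real scalars and the norm *)

Section CStar.
Context {R : realType} {A : cstarAlgType R}.
Implicit Types (x y z a b c f g h k p u v : A) (s t e : R).

#[local] Instance A_ring_ops :
  @Ncring.Ring_ops A 0 1 +%R *%R (fun x y => x - y) -%R eq := pz_ring_ops A.
#[local] Instance A_Ring : Ncring.Ring := pz_ring_Ring A.

Lemma starN x : star (- x) = - star x.
Proof. by apply: (addrI (star x)); rewrite -starD !subrr star0. Qed.

Lemma starB x y : star (x - y) = star x - star y.
Proof. by rewrite starD starN. Qed.

(** Real scalars are made elements of [A], so that scaling is a ring product, within reach of
    [ncring]. *)
Definition sc t : A := (t%:C)%C%:A.

Lemma sc0 : sc 0 = 0.
Proof. by rewrite /sc scale0r. Qed.
Lemma sc1 : sc 1 = 1.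
Proof. by rewrite /sc scale1r. Qed.
Lemma scD s t : sc (s + t) = sc s + sc t.
Proof. by rewrite /sc rmorphD scalerDl. Qed.
Lemma scN s : sc (- s) = - sc s.
Proof. by rewrite /sc rmorphN scaleNr. Qed.
Lemma scB s t : sc (s - t) = sc s - sc t.
Proof. by rewrite scD scN. Qed.
Lemma scM s t : sc (s * t) = sc s * sc t.
Proof. by rewrite /sc rmorphM -scalerAl mul1r scalerA. Qed.
Lemma scC s x : sc s * x = x * sc s.
Proof. by rewrite /sc -scalerAl -scalerAr mul1r mulr1. Qed.
Lemma sc_comm s x : GRing.comm x (sc s).
Proof. by rewrite /GRing.comm scC. Qed.
Lemma star_sc s : star (sc s) = sc s.
Proof. by rewrite /sc starZ star1 -[(_ ^*)%R]/(conjc _) conjc_real. Qed.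
Lemma sc_half x : sc 2^-1 * (x + x) = x.
Proof.
have -> : x + x = sc (1 + 1) * x by rewrite scD sc1; ncring.
by rewrite mulrA -scM -[1 + 1]/(2) mulVf ?sc1 ?mul1r // pnatr_eq0.
Qed.

Notation "`[ x ]" := (cnorm x) (format "`[ x ]").

Lemma cnorm_sc s x : `[sc s * x] = `|s| * `[x].
Proof.
have := cnormZ ((s%:C)%C : R[i]) x.
rewrite /sc -scalerAl mul1r normc_def /= expr0n addr0 sqrtr_sqr.
by rewrite -[(_ * _)%C]rmorphM => /(@complexI R).
Qed.

Lemma cnorm0 : `[0 : A] = 0.
Proof. by rewrite -[0](mul0r (0 : A)) -sc0 cnorm_sc normr0 mul0r. Qed.

Lemma cnormN x : `[- x] = `[x].
Proof. by rewrite -mulN1r -sc1 -scN cnorm_sc normrN normr1 mul1r. Qed.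

Lemma cnormB x y : `[x - y] <= `[x] + `[y].
Proof. by rewrite -(cnormN y) cnormD. Qed.

Lemma cnorm_ge0 x : 0 <= `[x].
Proof. by have := cnormB x x; rewrite subrr cnorm0 -mulr2n pmulrn_lge0. Qed.

Lemma cnorm1 : `[1 : A] = 1.
Proof.
have := cnorm_starM (1 : A); rewrite star1 mulr1 expr2 => /esym/eqP.
rewrite -subr_eq0 -[X in _ - X]mulr1 -mulrBr mulf_eq0 => /orP[/eqP/cnorm0_eq0/eqP|].
  by rewrite oner_eq0.
by rewrite subr_eq0 => /eqP.
Qed.

Lemma cnorm_scalar s : `[sc s] = `|s|.
Proof. by rewrite -[sc s]mulr1 cnorm_sc cnorm1 mulr1. Qed.

(** Divide |x|^2 = |x^* x| <= |x^*| |x| by |x|. *)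
Lemma cnorm_le_star x : `[x] <= `[star x].
Proof.
have := cnormM (star x) x; rewrite cnorm_starM expr2.
have := cnorm_ge0 x; rewrite le_eqVlt => /orP[/eqP<- _|x0].
  exact: cnorm_ge0.
by rewrite ler_pM2r.
Qed.

Lemma cnorm_star x : `[star x] = `[x].
Proof.
by apply/le_anti; rewrite cnorm_le_star -{2}[x]starK cnorm_le_star.
Qed.

Lemma cnorm_sqr h : star h = h -> `[h * h] = `[h] ^+ 2.
Proof. by move=> {1}<-; rewrite cnorm_starM. Qed.

Lemma star_mul_eq0 x : star x * x = 0 -> x = 0.
Proof.
move=> xx; apply: cnorm0_eq0; apply/eqP; rewrite -sqrf_eq0 -cnorm_starM xx.
by rewrite cnorm0.
Qed.

(** Used to pass identities to limits: the error is bounded linearly in [e]. *)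
Lemma cnorm_le_eq0 x K : (forall e, 0 < e -> `[x] <= K * e) -> x = 0.
Proof.
move=> xK; apply: cnorm0_eq0; apply/eqP; rewrite -[_ == _]negbK; apply/negP => x0.
have {x0} x0 : 0 < `[x] by rewrite lt_def x0 cnorm_ge0.
have K0 : 0 < K by have := xK 1 ltr01; rewrite mulr1; apply: lt_le_trans.
have := xK (`[x] / (2 * K)); rewrite divr_gt0 ?mulr_gt0 // => /(_ isT).
have -> : K * (`[x] / (2 * K)) = `[x] / 2 by field; rewrite gt_eqF.
lra.
Qed.

(** * Convergence, square roots and the Neumann series *)

Definition cvg_to (w : nat -> A) (l : A) :=
  forall e, 0 < e -> exists N, forall n, (N <= n)%N -> `[w n - l] <= e.

(** [eta] increases to its supremum, and its increments bound those of [w], which is therefore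
    Cauchy. *)
Lemma dominated_cvg (w : nat -> A) (eta : nat -> R) (M : R) :
    (forall n, `[w n.+1 - w n] <= eta n.+1 - eta n) ->
    (forall n, eta n <= M) ->
  exists l, cvg_to w l.
Proof.
move=> we etaM.
have wd n d : `[w (d + n)%N - w n] <= eta (d + n)%N - eta n.
  elim: d => [|d IH]; first by rewrite !subrr cnorm0.
  have -> : w (d.+1 + n)%N - w n = (w (d + n).+1 - w (d + n)%N) + (w (d + n)%N - w n).
    by rewrite addSn; ncring.
  apply: le_trans (cnormD _ _) _; have := we (d + n)%N; rewrite addSn; lra.
have eta_mono n d : eta n <= eta (d + n)%N.
  by have := wd n d; have := cnorm_ge0 (w (d + n)%N - w n); lra.
pose E : set R := fun r => exists n, r = eta n.
have supE : has_sup E.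
  by split; [exists (eta 0%N), 0%N | exists M => r [n ->]].
have wcauchy e : 0 < e -> exists N, forall d, `[w (d + N)%N - w N] < e.
  move=> /(sup_adherent)/(_ supE)[_ [N ->] sN]; exists N => d.
  apply: le_lt_trans (wd _ _) _.
  have : eta (d + N)%N <= sup E by apply: ub_le_sup; [case: supE | exists (d + N)%N].
  by move: sN; lra.
have [|l lP] := @cnorm_complete R A w.
  move=> e e0; have [|N NP] := wcauchy (e / 2); first by rewrite divr_gt0.
  exists N => i j Ni Nj.
  have := cnormB (w i - w N) (w j - w N).
  have -> : w i - w N - (w j - w N) = w i - w j by ncring.
  have := NP (i - N)%N; have := NP (j - N)%N; rewrite !subnK //; lra.
by exists l => e /lP[N NP]; exists N => n /NP/ltW.
Qed.

Lemma cvg_to_comm w l x :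
  cvg_to w l -> (forall n, GRing.comm x (w n)) -> GRing.comm x l.
Proof.
move=> wl xw; apply/eqP; rewrite -subr_eq0; apply/eqP.
apply: (@cnorm_le_eq0 _ (2 * `[x])) => e /wl[N /(_ N (leqnn _)) NP].
have -> : x * l - l * x = (w N - l) * x - x * (w N - l).
  by rewrite mulrBl mulrBr xw; ncring.
apply: le_trans (cnormB _ _) _.
apply: le_trans (lerD (cnormM _ _) (cnormM _ _)) _.
have := ler_wpM2l (cnorm_ge0 x) NP; rewrite mulrC; lra.
Qed.

Lemma cvg_to_star w l :
  cvg_to w l -> (forall n, star (w n) = w n) -> star l = l.
Proof.
move=> wl sw; apply/eqP; rewrite -subr_eq0; apply/eqP.
apply: (@cnorm_le_eq0 _ 2) => e /wl[N /(_ N (leqnn _)) NP].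
have -> : star l - l = (w N - l) - star (w N - l) by rewrite starB sw; ncring.
by apply: le_trans (cnormB _ _) _; rewrite cnorm_star; lra.
Qed.

Lemma cvg_to_norm w l M : cvg_to w l -> (forall n, `[w n] <= M) -> `[l] <= M.
Proof.
move=> wl wM; apply/ler_addgt0Pr => e /wl[N /(_ N (leqnn _)) NP].
have := cnormB (w N) (w N - l); have -> : w N - (w N - l) = l by ncring.
by have := wM N; lra.
Qed.

(* [1 - y] is the square root of [1 - x]; the iteration is dominated by the same
   iteration started from the scalar [1], which increases to a limit [<= 1]. *)
Lemma sqrt_iteration x : `[x] <= 1 -> exists y,
  [/\ `[y] <= 1, (1 - y) * (1 - y) = 1 - x, star x = x -> star y = y &
      forall z, GRing.comm z x -> GRing.comm z y].
Proof.
move=> x1.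
(* A fixed point of y -> (x + y^2)/2 is a solution of (1 - y)^2 = 1 - x. *)
pose w := fix w n := if n is n'.+1 then sc 2^-1 * (x + w n' * w n') else 0.
pose eta := fix eta n := if n is n'.+1 then 2^-1 * (1 + eta n' * eta n') else 0 : R.
have eta01 n : 0 <= eta n <= 1.
  by elim: n => [|n /andP[e0 e1]] /=; [rewrite lexx ler01 | apply/andP; split; nra].
have weta n : `[w n] <= eta n.
  elim: n => [|n IH] /=; first by rewrite cnorm0.
  rewrite cnorm_sc ger0_norm ?invr_ge0 // ler_pM2l ?invr_gt0 //.
  apply: le_trans (cnormD _ _) (lerD x1 _); apply: le_trans (cnormM _ _) _.
  by apply: ler_pM => //; exact: cnorm_ge0.
have zw z n : GRing.comm z x -> GRing.comm z (w n).
  move=> zx; elim: n => [|n IH] /=; first exact: commr0.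
  by apply: commrM (sc_comm _ _) _; apply: commrD => //; apply: commrM.
(* Commuting iterates let the difference of squares in [dw] factor. *)
have wC i j : GRing.comm (w i) (w j) by apply: (zw); apply: commr_sym; apply: zw.
have dw n : `[w n.+1 - w n] <= eta n.+1 - eta n.
  elim: n => [|n IH]; first by rewrite /= !mulr0 !addr0 !subr0 cnorm_sc
    ger0_norm ?invr_ge0 // ler_pM2l ?invr_gt0.
  have -> : w n.+2 - w n.+1 = sc 2^-1 * ((w n.+1 + w n) * (w n.+1 - w n)).
    have -> : w n.+2 - w n.+1 =
      sc 2^-1 * (w n.+1 * w n.+1 - w n * w n) by rewrite /=; ncring.
    congr (_ * _); rewrite mulrDl !mulrBr (wC n n.+1); ncring.
  have -> : eta n.+2 - eta n.+1 = 2^-1 * ((eta n.+1 + eta n) * (eta n.+1 - eta n)).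
    by rewrite /=; ring.
  rewrite cnorm_sc ger0_norm ?invr_ge0 // ler_pM2l ?invr_gt0 //.
  apply: le_trans (cnormM _ _) _; apply: ler_pM; rewrite ?cnorm_ge0 //.
  by apply: le_trans (cnormD _ _) _; apply: lerD.
have [y wy] := dominated_cvg dw (fun n => proj2 (andP (eta01 n))).
have w1 n : `[w n] <= 1 by apply: le_trans (weta n) _; case/andP: (eta01 n).
have y1 : `[y] <= 1 := cvg_to_norm wy w1.
exists y; split=> //; last 1 first.
- by move=> z zx; apply: cvg_to_comm wy _ => n; apply: zw.
- apply/eqP; rewrite -subr_eq0; apply/eqP.
  apply: (@cnorm_le_eq0 _ 4) => e /wy[N NP].
  have wN : w N.+1 + w N.+1 = x + w N * w N.
    by rewrite -mulrDr sc_half.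
  have -> : (1 - y) * (1 - y) - (1 - x) =
    ((w N.+1 - y) + (w N.+1 - y)) - ((w N - y) * w N + y * (w N - y)).
    have -> : x = w N.+1 + w N.+1 - w N * w N by rewrite wN; ncring.
    ncring.
  have n0 := NP N (leqnn _); have n1 := NP N.+1 (leqnSn _).
  apply: le_trans (cnormB _ _) _.
  have := cnormD (w N.+1 - y) (w N.+1 - y).
  have := cnormD ((w N - y) * w N) (y * (w N - y)).
  have := cnormM (w N - y) (w N); have := cnormM y (w N - y).
  have := ler_wpM2l (cnorm_ge0 (w N - y)) (w1 N).
  have := ler_wpM2r (cnorm_ge0 (w N - y)) y1.
  lra.
- move=> sx; apply: cvg_to_star wy _; elim=> [|n IH] /=; first exact: star0.
  by rewrite starM star_sc starD sx starM IH scC.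
Qed.

(** The partial sums of the powers of [x] are dominated by the geometric series of |x|. Their
    recursion gives a left inverse; the commutation clause makes it two-sided. *)
Lemma neumann_series x : `[x] < 1 -> exists y,
  y * (1 - x) = 1 /\ forall z, GRing.comm z x -> GRing.comm z y.
Proof.
move=> x1; set r := `[x].
have r1 : 0 < 1 - r by rewrite subr_gt0.
pose w := fix w n := if n is n'.+1 then 1 + w n' * x else 0.
pose eta n := (1 - r ^+ n) / (1 - r).
have rn n : 0 <= r ^+ n by rewrite exprn_ge0 ?cnorm_ge0.
have dw n : `[w n.+1 - w n] <= eta n.+1 - eta n.
  have -> : eta n.+1 - eta n = r ^+ n.
    by rewrite /eta -mulrBl exprS; field; rewrite gt_eqF.
  elim: n => [|n IH]; first by rewrite /= mul0r addr0 subr0 cnorm1.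
  have -> : w n.+2 - w n.+1 = (w n.+1 - w n) * x by rewrite /=; ncring.
  by apply: le_trans (cnormM _ _) _; rewrite exprSr ler_wpM2r ?cnorm_ge0.
have etaM n : eta n <= (1 - r)^-1.
  rewrite /eta -[leRHS]mul1r ler_pM2r ?invr_gt0 //; have := rn n; lra.
have [y wy] := dominated_cvg dw etaM; exists y; split; last first.
  move=> z zx; apply: cvg_to_comm wy _; elim=> [|n IH] /=; first exact: commr0.
  by apply: commrD (commr1 _) _; apply: commrM.
apply/eqP; rewrite -subr_eq0; apply/eqP.
apply: (@cnorm_le_eq0 _ 2) => e /wy[N NP].
have -> : y * (1 - x) - 1 = (w N - y) * x - (w N.+1 - y) by rewrite /=; ncring.
have n0 := NP N (leqnn _); have n1 := NP N.+1 (leqnSn _).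
apply: le_trans (cnormB _ _) _; have := cnormM (w N - y) x.
have := ler_wpM2l (cnorm_ge0 (w N - y)) (ltW x1).
lra.
Qed.

(** * Positivity *)

(** The norm condition places the spectrum of [a] in [0, 2t]; with it, sums of positive elements are
    positive by the triangle inequality. *)
Definition psd a := star a = a /\ exists t, `[sc t - a] <= t.

Lemma psd_sa a : psd a -> star a = a.
Proof. by case. Qed.

Lemma psdD a b : psd a -> psd b -> psd (a + b).
Proof.
move=> [sa [s as_]] [sb [t bt]]; split; first by rewrite starD sa sb.
exists (s + t); have -> : sc (s + t) - (a + b) = (sc s - a) + (sc t - b).
  by rewrite scD; ncring.
exact: le_trans (cnormD _ _) (lerD _ _).
Qed.

Lemma psd_sum (I : Type) (r : seq I) (F : I -> A) :
  (forall i, psd (F i)) -> psd (\sum_(i <- r) F i).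
Proof.
move=> F0; elim/big_ind: _ => //; last exact: psdD.
by split; [exact: star0 | exists 0; rewrite subr0 sc0 cnorm0].
Qed.

Lemma psd_sc t : 0 <= t -> psd (sc t).
Proof. by move=> t0; split; [exact: star_sc | exists t; rewrite subrr cnorm0]. Qed.

Lemma psd_sc_mul t a : 0 <= t -> psd a -> psd (sc t * a).
Proof.
move=> t0 [sa [s as_]]; split; first by rewrite starM sa star_sc scC.
by exists (t * s); rewrite scM -mulrBr cnorm_sc ger0_norm // ler_wpM2l.
Qed.

Lemma psd_sc_sub t a : star a = a -> `[a] <= t -> psd (sc t - a).
Proof.
move=> sa at_; split; first by rewrite starB sa star_sc.
by exists t; have -> : sc t - (sc t - a) = a by ncring.
Qed.

Lemma psd_sc_add t a : star a = a -> `[a] <= t -> psd (sc t + a).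
Proof.
by move=> sa at_; rewrite -[a]opprK; apply: psd_sc_sub; rewrite ?starN ?sa ?cnormN.
Qed.

(** After rescaling by s^2, the element 1 - a/s^2 has norm at most 1 and [sqrt_iteration] applies;
    the scale is a square so that its own root is [s]. *)
Lemma psd_sqrt a : psd a -> exists b,
  [/\ star b = b, b * b = a, psd b & forall z, GRing.comm z a -> GRing.comm z b].
Proof.
move=> [sa [t ta]].
(* Any number above an admissible [t] is admissible, in particular (1 + |t|)^2. *)
have [s [s0 sa1]] : exists s, 0 < s /\ `[sc (s * s) - a] <= s * s.
  have t0 := normr_ge0 t; have tt := ler_norm t.
  exists (1 + `|t|); split; first lra.
  set S := (_ * _ : R); have tS : t <= S by rewrite /S; nra.
  have -> : sc S - a = sc (S - t) + (sc t - a) by rewrite scB; ncring.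
  apply: le_trans (cnormD _ _) _; rewrite cnorm_scalar ger0_norm ?subr_ge0 //.
  lra.
set S := s * s in sa1; have S0 : 0 < S by rewrite mulr_gt0.
have SV : sc S * sc S^-1 = 1 by rewrite -scM mulfV ?sc1 ?gt_eqF.
pose x := 1 - sc S^-1 * a.
have x1 : `[x] <= 1.
  have -> : x = sc S^-1 * (sc S - a) by rewrite mulrBr -scC SV.
  by rewrite cnorm_sc gtr0_norm ?invr_gt0 // mulrC ler_pdivrMr // mul1r.
have [y [y1 yy sy yC]] := sqrt_iteration x1.
have {}sy : star y = y by apply: sy; rewrite /x starB star1 starM sa star_sc scC.
exists (sc s * (1 - y)); split.
- by rewrite starM starB star1 star_sc sy // scC.
- have -> : sc s * (1 - y) * (sc s * (1 - y)) = sc S * ((1 - y) * (1 - y)).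
    by rewrite /S scM -mulrA [(1 - y) * (sc s * _)]mulrA -[(1 - y) * sc s]scC !mulrA.
  by rewrite yy /x opprB addrC subrK mulrA SV mul1r.
- apply: psd_sc_mul (ltW s0) _; split; first by rewrite starB star1 sy.
  by exists 1; rewrite sc1; have -> : 1 - (1 - y) = y by ncring.
- move=> z za; apply: commrM (sc_comm _ _) (commrB (commr1 _) (yC _ _)).
  by apply: commrB (commr1 _) (commrM (sc_comm _ _) za).
Qed.

Lemma imaginary_unit : exists j : A,
  [/\ forall x, j * x = x * j, j * j = -1 & star j = - j].
Proof.
exists ('i%C : R[i])%:A; split=> [x||].
- by rewrite -scalerAl -scalerAr mul1r mulr1.
- rewrite -scalerAl mul1r scalerA -[in RHS]sc1 -scN; congr (_ *: _).
  by apply/eqP; rewrite eq_complex /= !mul0r !mul1r !sub0r !addr0 !eqxx.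
- rewrite starZ star1 -scaleNr; congr (_ *: _).
  by apply/eqP; rewrite eq_complex /= !oppr0 !eqxx.
Qed.

Lemma cnorm_sqr_le h k s : star h = h -> star k = k -> GRing.comm h k ->
  h * h + k * k = sc s -> 0 <= s -> `[h * h] <= s.
Proof.
move=> sh sk hk hks s0; have [j [jC jj sj]] := imaginary_unit.
pose u := h + j * k.
have su : star u = h - j * k by rewrite /u starD starM sh sk sj mulrN jC.
have uu : star u * u = sc s.
  have -> : star u * u = h * h - (j * (k * j)) * k + ((h * j) * k - (j * k) * h).
    by rewrite su /u; ncring.
  have -> : j * (k * j) = - k by rewrite -(jC k) mulrA jj mulN1r.
  have -> : h * j * k = j * k * h by rewrite -jC -!mulrA hk.
  by rewrite -hks; ncring.
have u2 : `[u] ^+ 2 = s by rewrite -cnorm_starM uu cnorm_scalar ger0_norm.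
rewrite cnorm_sqr // -u2 lerXn2r ?nnegrE ?cnorm_ge0 //.
have -> : h = sc 2^-1 * (u + star u).
  have -> : u + star u = h + h.
    by rewrite su /u; ncring.
  by rewrite sc_half.
rewrite cnorm_sc ger0_norm ?invr_ge0 //.
have := cnormD u (star u); rewrite cnorm_star; lra.
Qed.

(* If [a = h^2] with [|a| <= s] and [k^2 = s - a], then [h + ik] is [sqrt s] times
   a unitary, so [|k|^2 <= s]. *)
Lemma cnorm_sc_sub_sqr h s : star h = h -> `[h * h] <= s -> `[sc s - h * h] <= s.
Proof.
move=> sh hs; have shh : star (h * h) = h * h by rewrite starM sh.
have [k [sk kk _ kC]] := psd_sqrt (psd_sc_sub shh hs).
rewrite -kk; apply: cnorm_sqr_le (sk) (sh) _ _ (le_trans (cnorm_ge0 _) hs).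
  apply: commr_sym; apply: kC; apply: commrB (sc_comm _ _) _.
  by apply: commrM; exact: commr_refl.
by rewrite kk; ncring.
Qed.

Lemma psd_sqr h : star h = h -> psd (h * h).
Proof.
move=> sh; split; first by rewrite starM sh.
by exists `[h * h]; apply: cnorm_sc_sub_sqr.
Qed.

(** Frees [psd] from its existential witness: any bound on |a| will serve. *)
Lemma cnorm_sc_sub_psd a s : psd a -> `[a] <= s -> `[sc s - a] <= s.
Proof. by move=> /psd_sqrt[h [sh <- _ _]]; apply: cnorm_sc_sub_sqr. Qed.

(** The square roots h and k commute as well, so the product is (hk)^2. *)
Lemma psdM a b : psd a -> psd b -> GRing.comm a b -> psd (a * b).
Proof.
move=> /psd_sqrt[h [sh <- _ hC]] /psd_sqrt[k [sk <- _ kC]] ab.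
have hk : GRing.comm h k := kC _ (commr_sym (hC _ (commr_sym ab))).
have -> : h * h * (k * k) = (h * k) * (h * k).
  by rewrite !mulrA -[h * h * k]mulrA [in LHS]hk !mulrA.
by apply: psd_sqr; rewrite starM sh sk hk.
Qed.

Lemma psd_cnorm_le c s : psd c -> psd (sc s - c) -> 0 <= s -> `[c] <= s.
Proof.
move=> /psd_sqrt[h [sh <- _ hC]] /psd_sqrt[k [sk kk _ kC]].
apply: cnorm_sqr_le sh sk _ _; last by rewrite kk; ncring.
apply: kC; apply: commrB (sc_comm _ _) _.
by apply: commrM; exact: commr_refl.
Qed.

Lemma psd_anti a : psd a -> psd (- a) -> a = 0.
Proof.
move=> pa na; apply: cnorm0_eq0; apply/le_anti; rewrite cnorm_ge0 andbT.
by apply: psd_cnorm_le; rewrite ?sc0 ?sub0r.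
Qed.

Lemma psd_sum_eq0 a b : psd a -> psd b -> a + b = 0 -> a = 0.
Proof. by move=> pa pb ab; apply: psd_anti => //; rewrite (addr0_eq ab). Qed.

Lemma inv_sa a g : star a = a -> g * a = 1 -> GRing.comm a g -> star g = g.
Proof.
move=> sa ga ag; have := congr1 star ga; rewrite starM sa star1 => asg.
by rewrite -[LHS]mul1r -ga -mulrA asg mulr1.
Qed.

Lemma inv_comm a g z : g * a = 1 -> a * g = 1 -> GRing.comm z a -> GRing.comm z g.
Proof.
move=> ga ag za; rewrite /GRing.comm -[LHS]mul1r -ga -!mulrA [a * _]mulrA -za.
by rewrite -[z * a * g]mulrA ag mulr1.
Qed.

(** With t = |a|, a + e = (t + e)(1 - x) where |x| <= t/(t + e) < 1, and the Neumann series inverts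
    1 - x. The inverse is positive because g = (a + e) g^2. *)
Lemma psd_inv a e : psd a -> 0 < e -> exists g,
  [/\ psd g, (a + sc e) * g = 1, g * (a + sc e) = 1 &
      forall z, GRing.comm z a -> GRing.comm z g].
Proof.
move=> pa e0; case: (pa) => sa _; set t := `[a].
have t0 : 0 <= t := cnorm_ge0 a.
have te : 0 < t + e by lra.
have ta : `[sc t - a] <= t by apply: cnorm_sc_sub_psd.
have teE : sc (t + e)^-1 * sc (t + e) = 1 by rewrite -scM mulVf ?sc1 ?gt_eqF.
pose x := sc (t + e)^-1 * (sc t - a).
have x1 : `[x] < 1.
  rewrite /x cnorm_sc ger0_norm ?invr_ge0 ?ltW // mulrC ltr_pdivrMr // mul1r.
  lra.
have xE : 1 - x = sc (t + e)^-1 * (a + sc e).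
  by rewrite /x -teE scD; ncring.
have [y [y1 yC]] := neumann_series x1.
pose g := y * sc (t + e)^-1.
have gC z : GRing.comm z a -> GRing.comm z g.
  move=> za; apply: commrM (sc_comm _ _); apply: yC.
  exact: commrM (sc_comm _ _) (commrB (sc_comm _ _) za).
have ga : g * (a + sc e) = 1 by rewrite /g -mulrA -xE.
have ag : (a + sc e) * g = 1.
  rewrite -ga; apply/commr_sym; apply: commrD (sc_comm _ _).
  by apply/commr_sym/gC; exact: commr_refl.
have pae : psd (a + sc e) by apply: psdD pa (psd_sc (ltW e0)).
have sg : star g = g.
  by apply: (inv_sa (psd_sa pae) ga); rewrite /GRing.comm ag ga.
exists g; split=> //.
have -> : g = (a + sc e) * (g * g) by rewrite mulrA ag mul1r.
apply: psdM pae (psd_sqr sg) _.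
by rewrite /GRing.comm mulrA ag mul1r -mulrA ga mulr1.
Qed.

(** The witness for a + e can be taken to be |a| + e, so |a| works for [a] up to [e]. *)
Lemma psd_closed a : (forall e, 0 < e -> psd (a + sc e)) -> psd a.
Proof.
move=> ae; split.
  have /psd_sa := ae 1 ltr01; rewrite starD star_sc; exact: addIr.
exists `[a]; apply/ler_addgt0Pr => e e0.
have -> : sc `[a] - a = sc (`[a] + e) - (a + sc e) by rewrite scD; ncring.
apply: cnorm_sc_sub_psd (ae _ e0) _; apply: le_trans (cnormD _ _) _.
by rewrite cnorm_scalar gtr0_norm.
Qed.

(* Up to [e], [b + a = (b + e)(1 + a (b + e)^-1)], where the second factor is
   positive because [|a (b + e)^-1| = |b (b + e)^-1| <= 1]. *)
Lemma psd_absD a b : star a = a -> psd b -> b * b = a * a -> GRing.comm a b ->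
  psd (b + a).
Proof.
move=> sa pb bbaa ab; apply: psd_closed => e e0.
have [g [pg bg gb gC]] := psd_inv pb e0.
have cbg : GRing.comm b g by apply/gC; exact: commr_refl.
have cag : GRing.comm a g by apply: gC.
have sb := psd_sa pb; have sg := psd_sa pg.
have f1 : `[a * g] <= 1.
  have bg1 : `[b * g] <= 1.
    apply: psd_cnorm_le; rewrite ?ler01 //; first exact: psdM.
    have -> : sc 1 - b * g = sc e * g by rewrite sc1 -bg; ncring.
    exact: psd_sc_mul (ltW e0) pg.
  (* Both |ag|^2 and |bg|^2 are the norm of a^2 g^2 = b^2 g^2. *)
  have sq x : GRing.comm x g -> x * g * (x * g) = x * x * (g * g).
    by move=> xg; rewrite !mulrA -[x * g * x]mulrA -xg !mulrA.
  rewrite -(ler_pXn2r (n := 2)) ?nnegrE ?cnorm_ge0 ?ler01 //.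
  rewrite -cnorm_sqr; last by rewrite starM sa sg cag.
  rewrite sq // -bbaa -sq // cnorm_sqr; last by rewrite starM sb sg cbg.
  by rewrite lerXn2r ?nnegrE ?cnorm_ge0 ?ler01.
have -> : b + a + sc e = (b + sc e) * (1 + a * g).
  have beC : (b + sc e) * a = a * (b + sc e).
    by rewrite mulrDr mulrDl ab scC.
  by rewrite mulrDr mulrA beC -mulrA bg; ncring.
apply: psdM.
- exact: psdD pb (psd_sc (ltW e0)).
- by rewrite -sc1; apply: psd_sc_add; rewrite // starM sa sg cag.
- apply: commrD (commr1 _) _; apply: commrM.
    by apply/commr_sym; apply: commrD ab (sc_comm _ _).
  by rewrite /GRing.comm bg gb.
Qed.

(** Positive and negative parts (d + a)/2 and (d - a)/2, where [d] is the square root of a^2; their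
    product vanishes since d^2 = a^2. *)
Lemma sa_decomposition a : star a = a -> exists b c,
  [/\ psd b, psd c, a = b - c, b * c = 0 & forall z, GRing.comm z a -> GRing.comm z c].
Proof.
move=> sa; have [d [sd dd pd dC]] := psd_sqrt (psd_sqr sa).
have ad : GRing.comm a d by apply: dC; apply: commrM; exact: commr_refl.
have p1 : psd (d + a) by apply: psd_absD.
have p2 : psd (d - a).
  apply: psd_absD => //; rewrite ?starN ?sa ?mulrNN //.
  by apply/commr_sym/commrN/commr_sym.
exists (sc 2^-1 * (d + a)), (sc 2^-1 * (d - a)); split.
- by apply: psd_sc_mul p1; rewrite invr_ge0.
- by apply: psd_sc_mul p2; rewrite invr_ge0.
- rewrite -mulrBr; have -> : d + a - (d - a) = a + a by ncring.
  by rewrite sc_half.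
- rewrite mulrA -[_ * _ * sc _]mulrA -scC mulrA -mulrA.
  have -> : (d + a) * (d - a) = 0.
    by rewrite mulrBr !mulrDl dd ad; ncring.
  by rewrite mulr0.
- move=> z za; apply: commrM (sc_comm _ _) (commrB (dC _ _) za).
  by apply: commrM.
Qed.

(* Were [|b|] a value where [|b| - b] is invertible on the range of [b], one would
   get [l * b^3 <= (l * |b| - 1) * b^2] for large [l], which is too small in norm. *)
Lemma psd_eq0_of_inv b g : psd b -> star g = g -> GRing.comm b g ->
  b = b * (sc `[b] - b) * g -> b = 0.
Proof.
move=> pb sg bg bE; pose s := `[b]; rewrite -/s in bE.
have [s0|s0] : s = 0 \/ 0 < s.
  by have := cnorm_ge0 b; rewrite le_eqVlt => /orP[/eqP/esym|]; auto.
  exact: cnorm0_eq0.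
exfalso.
have sb := psd_sa pb; set w := sc s - b in bE.
have pw : psd w by apply: psd_sc_sub.
have bw : GRing.comm b w by apply: commrB (sc_comm _ _) (commr_refl _).
have gw : GRing.comm g w by apply: commrB (sc_comm _ _) (commr_sym bg).
have sgg : star (g * g) = g * g by rewrite starM sg.
(* The first summand makes G - g^2 positive; the second gives G s^2 >= 1, so that L s - 1 >= 0 for L
   = G s. *)
set G := `[g * g] + (s * s)^-1.
have G0 : 0 < G by rewrite ltr_wpDl ?cnorm_ge0 // invr_gt0 mulr_gt0.
have Gss : 1 <= G * s * s.
  rewrite -mulrA /G mulrDl mulVf ?gt_eqF ?mulr_gt0 // lerDr.
  by rewrite mulr_ge0 ?cnorm_ge0 ?mulr_ge0 ?ltW.
have pG : psd (sc G - g * g).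
  by apply: psd_sc_sub => //; rewrite lerDl invr_ge0 mulr_ge0 ?ltW.
have cG z : GRing.comm z g -> GRing.comm z (sc G - g * g).
  by move=> zg; apply: commrB (sc_comm _ _) (commrM zg zg).
have pbb : psd (b * b) by apply: psd_sqr.
have bbE : b * b = b * b * (w * w * (g * g)).
  rewrite -!expr2 -exprMn_comm; last exact: commr_sym.
  rewrite -exprMn_comm; last exact: commrM.
  by congr (_ ^+ 2); rewrite {1}bE mulrA.
(* A visibly positive form of L w - w^2 g^2; multiplied by b^2 it becomes L b^2 w - b^2, by
   [bbE]. *)
set p := sc G * (w * b) + w * w * (sc G - g * g).
have pp : psd p.
  apply: psdD; first by apply: psd_sc_mul (ltW G0) _; apply: psdM => //; exact: commr_sym.
  apply: psdM => //; first exact: psd_sqr (psd_sa pw).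
  by apply/cG/commr_sym/commrM.
have pE : p = sc (G * s) * w - w * w * (g * g).
  have -> : sc (G * s) * w = sc G * (w * sc s) by rewrite scM -mulrA [sc s * w]scC.
  have -> : sc s = b + w by rewrite /w; ncring.
  by rewrite /p [w * w * (_ - _)]mulrBr -(scC G (w * w)); ncring.
set L := G * s in Gss pE; have L0 : 0 < L by rewrite mulr_gt0.
have pb3 : psd (b * b * b).
  by apply: psdM => //; apply/commr_sym/commrM; exact: commr_refl.
have bp : GRing.comm b p.
  apply: commrD; first exact: commrM (sc_comm _ _) (commrM bw (commr_refl _)).
  exact: commrM (commrM bw bw) (cG _ bg).
have bbC : GRing.comm (b * b) p.
  by apply: commr_sym; apply: commrM; apply: commr_sym.
have : `[sc L * (b * b * b)] <= (L * s - 1) * (s * s).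
  apply: psd_cnorm_le; first exact: psd_sc_mul (ltW L0) pb3.
    have -> : sc ((L * s - 1) * (s * s)) - sc L * (b * b * b) =
        b * b * p + sc (L * s - 1) * (sc (s * s) - b * b).
      have -> : b * b * p = sc (L * s - 1) * (b * b) - sc L * (b * b * b).
        have -> : b * b * p = sc L * (b * b * w) - b * b.
          have -> : sc L * (b * b * w) = b * b * (sc L * w).
            by rewrite mulrA (scC L (b * b)) mulrA.
          by rewrite pE mulrBr -bbE.
        by rewrite /w mulrBr -(scC s (b * b)) scB sc1 scM; ncring.
      by rewrite [sc (_ * (s * s))]scM; ncring.
    apply: psdD; first exact: psdM.
    apply: psd_sc_mul; first by rewrite subr_ge0.
    by apply: psd_sc_sub; [rewrite starM sb | rewrite cnorm_sqr].
  by rewrite mulr_ge0 ?subr_ge0 // mulr_ge0 ?ltW.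
(* Then |b^3| >= s^3, and the bound above would give L s^3 <= L s^3 - s^2. *)
have s4 : `[b * b * (b * b)] = s ^+ 4.
  by rewrite cnorm_sqr ?cnorm_sqr ?starM ?sb // -exprM.
have := cnormM (b * b * b) b; rewrite -[b * b * b * b]mulrA s4 -/s.
rewrite cnorm_sc gtr0_norm // exprSr ler_pM2r // => b3.
have := ler_wpM2l (ltW L0) b3; nra.
Qed.

(** On its negative part [c], [a] acts as -c, so the inverse g of a + |c| satisfies c = c (|c| - c)
    g and [psd_eq0_of_inv] kills [c]. *)
Lemma psd_of_invertible a : star a = a ->
  (forall s, 0 < s -> invertible (a + sc s)) -> psd a.
Proof.
move=> sa ainv; have [b [c [pb pc abc bc cC]]] := sa_decomposition sa.
have sc' := psd_sa pc; have sb := psd_sa pb.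
have ca : c * a = a * c by rewrite [RHS](cC a (commr_refl _)).
have cb : c * b = 0 by rewrite -sc' -sb -starM bc star0.
suff -> : a = b by [].
rewrite abc; suff -> : c = 0 by rewrite subr0.
have [//|c0] := eqVneq c 0.
have {c0} c0 : 0 < `[c].
  by rewrite lt_def cnorm_ge0 andbT; apply: contra_neq c0; exact: cnorm0_eq0.
have [g [ag ga]] := ainv _ c0.
have sas : star (a + sc `[c]) = a + sc `[c] by rewrite starD sa star_sc.
have cg : GRing.comm c g.
  by apply: inv_comm ga ag _; apply: commrD (sc_comm _ _).
apply: psd_eq0_of_inv pc _ cg _.
  by apply: (inv_sa sas ga); rewrite /GRing.comm ag ga.
have -> : c * (sc `[c] - c) = c * (a + sc `[c]).
  by rewrite abc mulrBr !mulrDr mulrN cb; ncring.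
by rewrite -mulrA ag mulr1.
Qed.

(** * From spectral positivity to the positivity of x^* x *)

Lemma psd_of_positive a : positive a -> psd a.
Proof.
move=> [sa pa]; apply: psd_of_invertible => // s s0; apply: contrapT => ninv.
have := pa (- (s%:C)%C) _; rewrite oppr_ge0 lecR leNgt s0 => H.
suff : false by []; apply: H; rewrite /spectrum /=.
by rewrite scaleNr opprK.
Qed.

(** Jacobson's formula: if g inverts xy + s, then (1 - y g x)/s inverts yx + s. *)
Lemma invertible_swap x y s : s != 0 ->
  invertible (x * y + sc s) -> invertible (y * x + sc s).
Proof.
move=> s0 [g [xg gx]].
have sV : sc s * sc s^-1 = 1 by rewrite -scM mulfV ?sc1.
exists (sc s^-1 * (1 - y * g * x)).
have e1 : (y * x + sc s) * (1 - y * g * x) = sc s.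
  have -> : (y * x + sc s) * (1 - y * g * x) =
    y * x + sc s - y * (x * y * g) * x - sc s * y * g * x by ncring.
  have -> : x * y * g = 1 - sc s * g by rewrite -xg; ncring.
  by rewrite mulrBr mulr1 mulrBl [y * (sc s * g)]mulrA -scC; ncring.
have e2 : (1 - y * g * x) * (y * x + sc s) = sc s.
  have -> : (1 - y * g * x) * (y * x + sc s) =
    y * x + sc s - y * (g * (x * y)) * x - y * g * (x * sc s) by ncring.
  have -> : g * (x * y) = 1 - g * sc s by rewrite -gx; ncring.
  by rewrite -(scC s x) mulrBr mulr1 mulrBl; ncring.
split; last by rewrite -mulrA e2 -scM mulVf ?sc1.
by rewrite mulrA -scC -mulrA e1 -scM mulVf ?sc1.
Qed.

Lemma psd_star_swap x : psd (x * star x) -> psd (star x * x).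
Proof.
move=> px; apply: psd_of_invertible => [|s s0]; first by rewrite starM starK.
apply: invertible_swap; first by rewrite gt_eqF.
by have [g [_ h1 h2 _]] := psd_inv px s0; exists g.
Qed.

(** With [h] twice the real part of [x] and [k], up to sign, twice its imaginary part, the sum is
    (h^2 + k^2)/2. *)
Lemma psd_star_add x : psd (star x * x + x * star x).
Proof.
have [j [jC jj sj]] := imaginary_unit.
pose h := x + star x; pose k := j * (x - star x).
have sh : star h = h by rewrite /h starD starK addrC.
have sk : star k = k.
  by rewrite /k starM starB starK sj mulrN -jC -mulrN opprB.
suff -> : star x * x + x * star x = sc 2^-1 * (h * h + k * k).
  by apply: psd_sc_mul; [rewrite invr_ge0 | apply: psdD; apply: psd_sqr].
have -> : k * k = - ((x - star x) * (x - star x)).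
  rewrite /k; set z := x - star x.
  have -> : j * z * (j * z) = j * (z * j) * z by ncring.
  by rewrite -jC [j * (j * z)]mulrA jj; ncring.
rewrite -[LHS]sc_half; congr (_ * _); rewrite /h; ncring.
Qed.

(* With [x^* x = b - c], [b c = 0], the element [y = x c] has [- y^* y = c^3]
   positive; then so is [y y^*], and by [psd_star_swap] also [y^* y]. *)
Lemma psd_star_mul x : psd (star x * x).
Proof.
have sx : star (star x * x) = star x * x by rewrite starM starK.
have [b [c [pb pc abc bc cC]]] := sa_decomposition sx.
have sc' := psd_sa pc.
have cb : c * b = 0 by rewrite -sc' -(psd_sa pb) -starM bc star0.
suff c0 : c = 0 by rewrite abc c0 subr0.
pose y := x * c.
have yy : star y * y = - (c * c * c).
  rewrite /y starM sc'; have -> : c * star x * (x * c) = c * (star x * x) * c by ncring.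
  by rewrite abc mulrBr cb; ncring.
have pny : psd (- (star y * y)).
  rewrite yy opprK; apply: psdM => //; first exact: psd_sqr.
  by apply: commr_sym; apply: commrM; exact: commr_refl.
have py : psd (y * star y).
  have -> : y * star y = (star y * y + y * star y) + - (star y * y) by ncring.
  exact: psdD (psd_star_add y) pny.
have /star_mul_eq0 y0 := psd_anti (psd_star_swap py) pny.
(* From x c = 0 one gets 0 = x^* x c = (b - c) c = -c^2. *)
apply: star_mul_eq0; rewrite sc'; apply/eqP; rewrite -oppr_eq0; apply/eqP.
have : star x * y = 0 by rewrite y0 mulr0.
by rewrite /y mulrA abc mulrBl bc sub0r.
Qed.

Lemma psd_conj x a : psd a -> psd (star x * a * x).
Proof.
move=> /psd_sqrt[h [sh <- _ _]].
by have := psd_star_mul (h * x); rewrite starM sh !mulrA.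
Qed.

Lemma psd_conj_eq0 x a : psd a -> star x * a * x = 0 -> a * x = 0.
Proof.
move=> /psd_sqrt[h [sh <- _ _]] xax; rewrite -mulrA.
have -> : h * x = 0 by apply: star_mul_eq0; rewrite starM sh -xax !mulrA.
by rewrite mulr0.
Qed.

Lemma starMM x y z u : star (x * y) * (z * u) = star y * (star x * z) * u.
Proof. by rewrite starM !mulrA. Qed.

Lemma projP p : projection p -> p * p = p /\ star p = p.
Proof. by move=> /andP[/eqP pp /eqP sp]. Qed.

Lemma projection1B p : projection p -> projection (1 - p).
Proof.
move=> /projP[pp sp]; apply/andP; split; apply/eqP; last by rewrite starB star1 sp.
by rewrite mulrBr mulr1 mulrBl pp mul1r subrr subr0.
Qed.

Lemma cnorm_projection p : projection p -> `[p] <= 1.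
Proof.
move=> /projP[pp sp]; have := cnorm_sqr sp; rewrite pp expr2 => np.
by have := cnorm_ge0 p; rewrite leNgt => p0; nra.
Qed.

(** * Corners and fullness in purely infinite algebras *)

Definition corner p : set A := fun x => p * x * p = x.

Lemma corner_closed p : projection p -> norm_closed (corner p).
Proof.
move=> hp x xc; have p1 := cnorm_projection hp.
rewrite /corner; apply/eqP; rewrite -subr_eq0; apply/eqP.
apply: (@cnorm_le_eq0 _ 2) => e /xc[y yp yx].
have -> : p * x * p - x = p * (x - y) * p - (x - y).
  have -> : p * (x - y) * p = p * x * p - p * y * p by ncring.
  by rewrite yp; ncring.
apply: le_trans (cnormB _ _) _.
have c1 := cnormM (p * (x - y)) p; have c2 := cnormM p (x - y).
have := ler_wpM2l (cnorm_ge0 (p * (x - y))) p1.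
have := ler_wpM2r (cnorm_ge0 (x - y)) p1.
lra.
Qed.

(** For 0 <= a <= b with [b] in pAp and q = 1 - p, the positive elements q a q and q (b - a) q sum
    to q b q = 0; hence q a q = 0, and then a q = 0. *)
Lemma hereditary_corner p : projection p -> hereditary_subalgebra (corner p).
Proof.
move=> hp; have [pp sp] := projP hp; rewrite /corner; split; first split.
- split=> [|x y xp yp|c x xp]; rewrite ?mulr0 ?mul0r //.
    by rewrite mulrDr mulrDl xp yp.
  by rewrite -scalerAr -scalerAl xp.
- move=> x y xp yp; have px : p * x = x by rewrite -xp !mulrA pp.
  have {}yp : y * p = y by rewrite -yp -!mulrA pp.
  by rewrite mulrA px -mulrA yp.
- by move=> x xp; rewrite -[in RHS]xp !starM sp mulrA.
- exact: corner_closed.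
move=> a b bp /psd_of_positive pa /psd_of_positive pba.
pose q := 1 - p; have [qq sq] := projP (projection1B hp); rewrite -/q in qq sq.
have bq : b * q = 0.
  have {}bp : b * p = b by rewrite -bp -!mulrA pp.
  by rewrite /q mulrBr mulr1 bp subrr.
have aq : a * q = 0.
  apply: psd_conj_eq0 => //; apply: psd_sum_eq0 (psd_conj _ pa) (psd_conj q pba) _.
  have -> : star q * a * q + star q * (b - a) * q = star q * (b * q) by ncring.
  by rewrite bq mulr0.
have qa : q * a = 0 by rewrite -sq -(psd_sa pa) -starM aq star0.
have ap : a = a * p by apply/eqP; rewrite -subr_eq0 -aq /q mulrBr mulr1.
have pa' : a = p * a by apply/eqP; rewrite -subr_eq0 -qa /q mulrBl mul1r.
by rewrite -pa' -ap.
Qed.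

Definition generated x : set A := fun y => exists r : seq (A * A),
  y = \sum_(d <- r) d.1 * x * d.2.

Definition closed_generated x : set A :=
  fun y => forall e, 0 < e -> exists2 z, generated x z & `[y - z] <= e.

Lemma ideal_closed_generated x : two_sided_ideal (closed_generated x).
Proof.
split.
- move=> e e0; exists 0; first by exists [::]; rewrite big_nil.
  by rewrite subrr cnorm0 ltW.
- move=> y z xy xz e e0; have e2 : 0 < e / 2 by rewrite divr_gt0.
  have [_ [r ->] yr] := xy _ e2; have [_ [r' ->] zr] := xz _ e2.
  exists (\sum_(d <- r ++ r') d.1 * x * d.2); first by exists (r ++ r').
  rewrite big_cat /=; set u := \sum_(c <- r) _ in yr *; set v := \sum_(c <- r') _ in zr *.
  have -> : y + z - (u + v) = (y - u) + (z - v) by ncring.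
  by apply: le_trans (cnormD _ _) _; lra.
- move=> a y xy e e0; have a0 : 0 < `[a] + 1 by have := cnorm_ge0 a; lra.
  have [_ [r ->] yr] := xy (e / (`[a] + 1)) (divr_gt0 e0 a0).
  exists (a * \sum_(d <- r) d.1 * x * d.2).
    exists [seq (a * d.1, d.2) | d <- r]; rewrite big_map mulr_sumr.
    by apply: eq_bigr => d _; rewrite /= !mulrA.
  rewrite -mulrBr; apply: le_trans (cnormM _ _) _.
  move: yr; rewrite ler_pdivlMr //; have := cnorm_ge0 (y - \sum_(d <- r) d.1 * x * d.2).
  nra.
- move=> a y xy e e0; have a0 : 0 < `[a] + 1 by have := cnorm_ge0 a; lra.
  have [_ [r ->] yr] := xy (e / (`[a] + 1)) (divr_gt0 e0 a0).
  exists ((\sum_(d <- r) d.1 * x * d.2) * a).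
    exists [seq (d.1, d.2 * a) | d <- r]; rewrite big_map mulr_suml.
    by apply: eq_bigr => d _; rewrite /= !mulrA.
  rewrite -mulrBl; apply: le_trans (cnormM _ _) _.
  move: yr; rewrite ler_pdivlMr //; have := cnorm_ge0 (y - \sum_(d <- r) d.1 * x * d.2).
  nra.
Qed.

Lemma closed_generated_closed x : norm_closed (closed_generated x).
Proof.
move=> y yx e e0; have e2 : 0 < e / 2 by rewrite divr_gt0.
have [z xz yz] := yx _ e2; have [w xw zw] := xz _ e2; exists w => //.
have -> : y - w = (y - z) + (z - w) by ncring.
by apply: le_trans (cnormD _ _) _; lra.
Qed.

(** By simplicity the closed ideal generated by [x] contains 1. The bound 1/2 is what makes y + y^*
    >= 1 in [full_projection]. *)
Lemma generated_unit x : simple_cstar A -> x <> 0 ->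
  exists2 y, generated x y & `[1 - y] <= 2^-1.
Proof.
move=> As x0.
have xx : closed_generated x x.
  move=> e e0; exists x; last by rewrite subrr cnorm0 ltW.
  by exists [:: (1, 1)]; rewrite big_seq1 mul1r mulr1.
have [cx|cx] := As _ (ideal_closed_generated x) (@closed_generated_closed x).
  by exfalso; apply: x0; move: xx; rewrite cx.
have : closed_generated x 1 by rewrite cx.
by apply; rewrite invr_gt0.
Qed.

(* If [y = sum a_i f b_i] is within 1/2 of 1, then [1 <= y + y^* <= sum a_i f a_i^*
   + b_i^* f b_i] by expanding [(a_i^* - b_i)^* f (a_i^* - b_i) >= 0]. *)
Lemma full_projection f : simple_cstar A -> projection f -> f <> 0 ->
  exists r : seq A, \sum_(c <- r) star c * f * c = 1.
Proof.
move=> As hf f0; have [ff sf] := projP hf.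
have [_ [r ->] yr] := generated_unit As f0.
have pf : psd f by rewrite -ff; apply: psd_sqr.
pose d := flatten [seq [:: star d.1; d.2] | d <- r].
pose T := \sum_(c <- d) star c * f * c.
have pT : psd (T - 1).
  set y := \sum_(c <- r) _ in yr.
  have -> : T - 1 = \sum_(d <- r) (star (star d.1 - d.2) * f * (star d.1 - d.2)) +
     (sc 1 - ((1 - y) + star (1 - y))).
    have -> : T = \sum_(d <- r) (d.1 * f * star d.1 + star d.2 * f * d.2).
      rewrite /T /d big_flatten big_map; apply: eq_bigr => d' _.
      by rewrite big_cons big_seq1 starK.
    have -> : \sum_(d <- r) (star (star d.1 - d.2) * f * (star d.1 - d.2)) =
       \sum_(d <- r) (d.1 * f * star d.1 + star d.2 * f * d.2) - y - star y.
      rewrite /y star_sum -!sumrB; apply: eq_bigr => d' _.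
      by rewrite starB starK !starM sf; ncring.
    by rewrite sc1 starB star1; ncring.
  apply: psdD; first by apply: psd_sum => c; apply: psd_conj.
  apply: psd_sc_sub; first by rewrite starD starK addrC.
  by apply: le_trans (cnormD _ _) _; rewrite cnorm_star; lra.
(* T = (T - 1) + 1 has a positive inverse [g]; multiplying the coefficients by its root [h] turns
   the sum into h T h = 1. *)
have [g [pg Tg gT _]] := psd_inv pT ltr01.
have T1 : T - 1 + sc 1 = T by rewrite sc1 subrK.
rewrite T1 in Tg gT.
have [h [sh hh _ hC]] := psd_sqrt pg.
exists [seq c * h | c <- d]; rewrite big_map.
have -> : \sum_(c <- d) star (c * h) * f * (c * h) = h * T * h.
  rewrite /T mulr_sumr mulr_suml; apply: eq_bigr => c _.
  by rewrite starM sh !mulrA.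
have Th : GRing.comm T h by apply: hC; rewrite /GRing.comm Tg gT.
by rewrite -mulrA Th mulrA hh.
Qed.

(* From an infinite projection [r ~ r0 < r], implemented by [v], the projections
   [v^i (r - r0) v^*i] are pairwise orthogonal copies of [r - r0] below [r]; enough
   of them carry a copy of the unit. *)
Lemma isometry_below p : simple_cstar A -> purely_infinite A ->
  projection p -> p <> 0 -> exists s : A, star s * s = 1 /\ p * s = s.
Proof.
move=> As Api hp p0; have [pp sp] := projP hp.
have [|r rp [hr [r0 [[hr0 rr0] r0r [v [vr vr0]]]]]] := Api _ (hereditary_corner hp).
  move=> cp; apply: p0; suff : corner p p by rewrite cp.
  by rewrite /corner !pp.
have [rr sr] := projP hr; have [r0r0 sr0] := projP hr0.
have pr : p * r = r by rewrite -rp !mulrA pp.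
have v_r : v * r = v.
  apply/eqP; rewrite -subr_eq0; apply/eqP/star_mul_eq0.
  have -> : star (v * r - v) * (v * r - v) =
    r * (star v * v) * r - r * (star v * v) - (star v * v) * r + star v * v.
    by rewrite starB starM sr; ncring.
  by rewrite vr !rr subrr sub0r addNr.
have r0v : r0 * v = v by rewrite -vr0 -mulrA vr.
have rv : r * v = v by rewrite -r0v mulrA rr0.
(* The right factor [r] covers i = 0, where v^0 = 1 need not lie below [r]. *)
have rvi i : r * v ^+ i * r = v ^+ i * r.
  case: i => [|i]; first by rewrite expr0 mulr1 mul1r rr.
  by rewrite exprS mulrA rv.
pose f := r - r0.
have r0_r : r0 * r = r0 by rewrite -sr -sr0 -starM rr0 sr0.
have hf : projection f.
  rewrite /projection /f starB sr sr0 eqxx andbT mulrBr !mulrBl rr rr0 r0_r r0r0.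
  by rewrite subrr subr0.
have [ff sf] := projP hf.
have f0 : f <> 0 by move/eqP; rewrite subr_eq0 => /eqP rr0'; apply: r0r.
have fr : f * r = f by rewrite /f mulrBl rr r0_r.
have rf : r * f = f by rewrite /f mulrBr rr rr0.
have fv : f * v = 0 by rewrite -r0v mulrA /f mulrBl rr0 r0r0 subrr mul0r.
pose vi i := v ^+ i * f.
have vii i : star (vi i) * vi i = f.
  elim: i => [|i IH]; first by rewrite /vi expr0 mul1r sf ff.
  rewrite /vi exprS -mulrA starM -mulrA [star v * _]mulrA vr.
  have -> : r * (v ^+ i * f) = vi i by rewrite /vi -{1}rf !mulrA rvi -mulrA rf.
  exact: IH.
have vij i j : (i < j)%N -> star (vi i) * vi j = 0.
  elim: i j => [|i IH] [|j] //; rewrite ?ltnS => ij.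
    by rewrite /vi expr0 mul1r sf exprS !mulrA fv !mul0r.
  rewrite /vi !exprS -!mulrA starM -mulrA [star v * _]mulrA vr.
  have -> : r * (v ^+ j * f) = vi j by rewrite /vi -{1}rf !mulrA rvi -mulrA rf.
  exact: IH.
have vn i j : i != j -> star (vi i) * vi j = 0.
  rewrite neq_ltn => /orP[/vij //|/vij ji].
  by rewrite -[star _ * _]starK starM starK ji star0.
have [cs csE] := full_projection As hf f0.
(* Each coefficient goes through its own copy of [f], so the cross terms of s^* s vanish and the sum
   of the c_i^* f c_i remains. *)
pose s := \sum_(i < size cs) vi i * cs`_i.
exists s; split.
  rewrite /s star_sum mulr_suml -csE (big_nth 0) big_mkord; apply: eq_bigr => i _.
  rewrite mulr_sumr (bigD1 i) //= big1 ?addr0 => [|j ji].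
    by rewrite starMM vii.
  by rewrite starMM vn 1?eq_sym // mulr0 mul0r.
rewrite /s mulr_sumr; apply: eq_bigr => i _; rewrite mulrA; congr (_ * _).
case: (nat_of_ord i) => [|k]; rewrite /vi ?expr0 ?mul1r.
  by rewrite -rf mulrA pr.
by rewrite exprS -rv !mulrA pr.
Qed.

End CStar.

(** * The monoid of Murray-von Neumann classes *)

Section MvNMonoid.
Local Open Scope quotient_scope.
Context {A : starRingType}.

Definition mxcls n (p : 'M[A]_n) (hp : projection p) : MvN_monoid A :=
  \pi_(MvN_monoid A) (mxprojE hp).

Lemma mxcls_eq m n (p : 'M[A]_n) (q : 'M[A]_m)
    (hp : projection p) (hq : projection q) (v : 'M[A]_(m, n)) :
  mxstar v *m v = p -> v *m mxstar v = q -> mxcls hp = mxcls hq.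
Proof. by move=> vp vq; apply/MvN_piP; exists v. Qed.

Lemma mxcls_cong n (p q : 'M[A]_n) (hp : projection p) (hq : projection q) :
  p = q -> mxcls hp = mxcls hq.
Proof.
by move=> pq; move: hp hq; rewrite pq => hp hq; rewrite (bool_irrelevance hp hq).
Qed.

Lemma mxprojP n (p : 'M[A]_n) : projection p -> p *m p = p /\ mxstar p = p.
Proof. by move=> /andP[/eqP pp /eqP sp]. Qed.

(** The row (p q) is a partial isometry from the direct sum to p + q. *)
Lemma mxclsD n (p q : 'M[A]_n) (hp : projection p) (hq : projection q)
    (hpq : projection (p + q)) :
  p *m q = 0 -> mxcls hp + mxcls hq = mxcls hpq.
Proof.
move=> pq; have [pp sp] := mxprojP hp; have [qq sq] := mxprojP hq.
have qp : q *m p = 0 by rewrite -sq -sp -mxstarM pq mxstar0.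
rewrite [LHS]MvN_addE; apply/MvN_piP; exists (row_mx p q).
have -> : mxstar (row_mx p q) = col_mx p q.
  by rewrite /mxstar map_row_mx tr_row_mx -!/(mxstar _) sp sq.
by rewrite mul_col_row mul_row_col pp qq pq qp.
Qed.

Lemma mx_projection1B n (p : 'M[A]_n) : projection p -> projection (1%:M - p).
Proof.
move=> /mxprojP[pp sp]; apply/andP; split; apply/eqP.
  by rewrite /GRing.mul /= mulmxBr mulmx1 mulmxBl pp mul1mx subrr subr0.
apply: (addIr p); rewrite subrK -{2}sp -[LHS]mxstarD subrK.
exact: star1.
Qed.

Lemma mxstar_scalar n (a : A) : mxstar (a%:M : 'M_n) = (star a)%:M.
Proof.
apply/matrixP=> i j; rewrite !mxE eq_sym.
by case: eqP => _; rewrite ?star0 ?mulr0n ?mulr1n.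
Qed.

Lemma projection_scalar n (p : A) : projection p -> projection (p%:M : 'M_n).
Proof.
move=> /andP[/eqP pp /eqP sp]; apply/andP; split; apply/eqP.
  by rewrite /GRing.mul /= -scalar_mxM pp.
by rewrite [LHS]mxstar_scalar sp.
Qed.

Lemma projection1 : projection (1 : A).
Proof. by rewrite /projection mulr1 star1 !eqxx. Qed.

Definition cls (p : A) (hp : projection p) : MvN_monoid A :=
  mxcls (projection_scalar1 hp).

Lemma cls_eq (p q v : A) (hp : projection p) (hq : projection q) :
  star v * v = p -> v * star v = q -> cls hp = cls hq.
Proof.
move=> vp vq; apply: (@mxcls_eq _ _ _ _ _ _ v%:M);
  by rewrite mxstar_scalar -scalar_mxM ?vp ?vq.
Qed.

Lemma clsD (p q : A) (hp : projection p) (hq : projection q) (hpq : projection (p + q)) :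
  p * q = 0 -> cls hp + cls hq = cls hpq.
Proof.
move=> pq; have h : projection (p%:M + q%:M : 'M[A]_1).
  by rewrite -raddfD; exact: projection_scalar.
rewrite (mxclsD _ _ h) -?scalar_mxM ?pq ?raddf0 //.
by apply: mxcls_cong; rewrite raddfD.
Qed.

(** Diagonal entries are split off one by one; the zero of V(A) is the class of the empty matrix. *)
Lemma mxcls_scalar n (p : A) (hp : projection p) (hpn : projection (p%:M : 'M_n)) :
  mxcls hpn = cls hp *+ n.
Proof.
elim: n hpn => [|n IH] hpn.
  rewrite mulr0n -[0]/(mxcls (projection0 0)).
  by apply: mxcls_cong; apply/matrixP => -[].
rewrite mulrS -(IH (projection_scalar n hp)) [RHS]MvN_addE.
by apply: mxcls_cong; rewrite -[n.+1]/(1 + n)%N scalar_mx_block.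
Qed.

(** A projection r in M_k(A) is complemented by 1 - r; this bounds any class by a multiple of
    [1]. *)
Lemma MvN_monoid_complement (z : MvN_monoid A) :
  exists z' k, z + z' = cls projection1 *+ k.
Proof.
elim/quotW: z => -[k [r hr]].
exists (mxcls (mx_projection1B hr)), k.
rewrite -(mxcls_scalar _ (projection_scalar k projection1)).
have h1 : projection (r + (1%:M - r)).
  by rewrite addrC subrK; exact: projection_scalar projection1.
have [rr _] := mxprojP hr.
rewrite -[\pi_ _ _]/(mxcls hr) (mxclsD _ _ h1) ?mulmxBr ?mulmx1 ?rr ?subrr //.
by apply: mxcls_cong; rewrite addrC subrK.
Qed.

Lemma unitarily_equivalent_of_cls n (p q : 'M[A]_n) (hp : projection p)
    (hq : projection q) :
  mxcls hp = mxcls hq ->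
  mxcls (mx_projection1B hp) = mxcls (mx_projection1B hq) ->
  unitarily_equivalent p q.
Proof.
move=> /MvN_piP[/= v [vp vq]] /MvN_piP[/= w [wp wq]].
rewrite /val_mxproj /= in vp vq wp wq.
have [pp sp] := mxprojP hp; have [qq sq] := mxprojP hq.
have [pp' sp'] := mxprojP (mx_projection1B hp).
have [qq' sq'] := mxprojP (mx_projection1B hq).
have pp1 : p *m (1%:M - p) = 0 by rewrite mulmxBr mulmx1 pp subrr.
have p1p : (1%:M - p) *m p = 0 by rewrite mulmxBl mul1mx pp subrr.
have qq1 : q *m (1%:M - q) = 0 by rewrite mulmxBr mulmx1 qq subrr.
have q1q : (1%:M - q) *m q = 0 by rewrite mulmxBl mul1mx qq subrr.
set p1 := 1%:M - p in pp1 p1p pp' sp' wp; set q1 := 1%:M - q in qq1 q1q qq' sq' wq.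
have p1E : p + p1 = 1%:M by rewrite addrC subrK.
have q1E : q + q1 = 1%:M by rewrite addrC subrK.
clearbody p1 q1.
have v_p : v *m p = q *m v by rewrite -vp -vq mulmxA.
have w_p : w *m p1 = q1 *m w by rewrite -wp -wq mulmxA.
have pv : p *m mxstar v = mxstar v *m q by rewrite -vp -vq mulmxA.
have pw : p1 *m mxstar w = mxstar w *m q1 by rewrite -wp -wq mulmxA.
have p1v : p *m mxstar v = mxstar (v *m p) by rewrite mxstarM sp.
have p1w : p1 *m mxstar w = mxstar (w *m p1) by rewrite mxstarM sp'.
(* The factors [p] and [p1] are orthogonal, which removes the cross terms of u^* u; in u u^* those
   with [q] and [q1] do the same. *)
pose u := p *m mxstar v + p1 *m mxstar w.
have su : mxstar u = v *m p + w *m p1.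
  by rewrite /u p1v p1w -mxstarD mxstarK.
have sup : mxstar u *m p = v *m p.
  by rewrite su mulmxDl -!mulmxA pp p1p mulmx0 addr0.
have pu : p *m u = p *m mxstar v.
  by rewrite mulmxDr !mulmxA pp pp1 mul0mx addr0.
exists u; last first.
  by rewrite -[LHS]/(mxstar u *m p *m u) sup -mulmxA pu pv mulmxA vq qq.
split; [change (mxstar u *m u = 1%:M) | change (u *m mxstar u = 1%:M)]; rewrite su.
  rewrite /u mulmxDr !mulmxDl.
  have -> : v *m p *m (p *m mxstar v) = q.
    by rewrite -mulmxA [p *m (p *m _)]mulmxA pp pv mulmxA vq qq.
  have -> : w *m p1 *m (p *m mxstar v) = 0.
    by rewrite -mulmxA [p1 *m (p *m _)]mulmxA p1p mul0mx mulmx0.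
  have -> : v *m p *m (p1 *m mxstar w) = 0.
    by rewrite -mulmxA [p *m (p1 *m _)]mulmxA pp1 mul0mx mulmx0.
  have -> : w *m p1 *m (p1 *m mxstar w) = q1.
    by rewrite -mulmxA [p1 *m (p1 *m _)]mulmxA pp' pw mulmxA wq qq'.
  by rewrite addr0 add0r.
rewrite /u v_p w_p pv pw mulmxDr !mulmxDl.
have -> : mxstar v *m q *m (q *m v) = p.
  by rewrite -mulmxA [q *m (q *m _)]mulmxA qq -v_p mulmxA vp pp.
have -> : mxstar w *m q1 *m (q *m v) = 0.
  by rewrite -mulmxA [q1 *m (q *m _)]mulmxA q1q mul0mx mulmx0.
have -> : mxstar v *m q *m (q1 *m w) = 0.
  by rewrite -mulmxA [q *m (q1 *m _)]mulmxA qq1 mul0mx mulmx0.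
have -> : mxstar w *m q1 *m (q1 *m w) = p1.
  by rewrite -mulmxA [q1 *m (q1 *m _)]mulmxA qq' -w_p mulmxA wp pp'.
by rewrite addr0 add0r.
Qed.

(** * From K_0 back to V(A), up to a common summand *)

Lemma K0_class_muln (p : A) (hp : projection p) n :
  K0_class hp *+ n = \pi_(groth (MvN_monoid A)) (cls hp *+ n, 0).
Proof.
elim: n => [|n IH]; first by rewrite !mulr0n.
by rewrite !mulrS IH [LHS]groth_addE /= addr0.
Qed.

Lemma MvN_of_K0_class (p q : A) (hp : projection p) (hq : projection q) n :
  K0_class hp *+ n = K0_class hq *+ n ->
  exists z, cls hp *+ n + z = cls hq *+ n + z.
Proof.
rewrite !K0_class_muln => /groth_piP[z]; rewrite /= !addr0 => pq.
by exists z.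
Qed.

End MvNMonoid.

(** * Absorption and cancellation in V(A) *)

Lemma nmod_absorption (V : nmodType) (o f x x' : V) k :
  o = o + (o + f) -> x = o + x' -> x = x + (o + f) *+ k.
Proof.
move=> of_ xo; elim: k => [|k IH]; first by rewrite mulr0n addr0.
rewrite mulrS addrA -[x + (o + f)](_ : x = _) //.
by rewrite xo addrAC -of_.
Qed.

(** Both x and y absorb k(o + f), which contains k o = z + z'; the summand [z] thus made available
    lets the hypothesis exchange x and y. *)
Lemma nmod_cancellation (V : nmodType) (o f x x' y y' z z' : V) k :
  o = o + (o + f) -> x = o + x' -> y = o + y' -> z + z' = o *+ k ->
  x + z = y + z -> x = y.
Proof.
move=> of_ xo yo zz xz.
rewrite (nmod_absorption k of_ xo) (nmod_absorption k of_ yo) mulrnDl -zz.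
by rewrite !addrA xz.
Qed.

Section PurelyInfinite.
Context {R : realType} {A : cstarAlgType R}.
Hypotheses (A_simple : simple_cstar A) (A_pi : purely_infinite A).

Let o : MvN_monoid A := cls projection1.

Lemma cls_complement (p : A) (hp : projection p) :
  cls hp + cls (projection1B hp) = o.
Proof.
have h : projection (p + (1 - p)) by rewrite addrC subrK projection1.
rewrite (clsD _ _ h); last by have [pp _] := projP hp; rewrite mulrBr mulr1 pp subrr.
by apply: mxcls_cong; rewrite addrC subrK.
Qed.

(** The isometry s below [p] gives [1] = [s s^*], and the remainder is the class of p - s s^*. *)
Lemma unit_le_cls (p : A) (hp : projection p) :
  p <> 0 -> exists p', cls hp = o + p'.
Proof.
move=> p0; have [s [ss ps]] := isometry_below A_simple A_pi hp p0.
have [pp sp] := projP hp.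
have sps : star s * p = star s by rewrite -{1}sp -starM ps.
have hss : projection (s * star s).
  rewrite /projection starM starK eqxx andbT -mulrA [star s * _]mulrA ss mul1r.
  exact: eqxx.
have [sss _] := projP hss.
have hpss : projection (p - s * star s).
  rewrite /projection starB sp starM starK eqxx andbT mulrBr !mulrBl pp.
  by rewrite sss -mulrA sps mulrA ps subrr subr0.
have h : projection (s * star s + (p - s * star s)) by rewrite addrC subrK.
exists (cls hpss); have -> : o = cls hss by apply: (@cls_eq _ _ _ s).
rewrite (clsD _ _ h); first by apply: mxcls_cong; rewrite addrC subrK.
by rewrite mulrBr sss -mulrA sps subrr.
Qed.

(** Non-triviality of [p] puts a copy of [1] in both [p] and [1 - p], so [1] absorbs [1] + f; n > 0
    ensures that n[p] and n[q] contain [1]. *)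
Lemma cls_cancellation (p q : A) (hp : projection p) (hq : projection q) n z :
  (0 < n)%N -> p <> 0 -> p <> 1 -> q <> 0 ->
  cls hp *+ n + z = cls hq *+ n + z -> cls hp *+ n = cls hq *+ n.
Proof.
move=> n0 p0 p1 q0.
have [p' pE] := unit_le_cls hp p0; have [q' qE] := unit_le_cls hq q0.
have [|r rE] := unit_le_cls (projection1B hp).
  by move=> /eqP; rewrite subr_eq0 => /eqP/esym.
have [z' [k zz]] := MvN_monoid_complement z.
have oE : o = o + (o + (p' + r)).
  by rewrite -{1}(cls_complement hp) pE rE addrACA -addrA.
case: n n0 => // n _.
apply: (nmod_cancellation oE _ _ zz).
  by rewrite mulrS {1}pE -addrA.
by rewrite mulrS {1}qE -addrA.
Qed.

End PurelyInfinite.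

(** * Unitary equivalence in M_n(A) and its failure in A *)

Theorem proposition5p7 (R : realType) (A : cstarAlgType R)
    (A_simple : simple_cstar A) (A_pi : purely_infinite A)
    (n : nat) (n_gt0 : (0 < n)%N)
    (p q : A) (hp : projection p) (hq : projection q)
    (p_neq0 : p <> 0) (p_neq1 : p <> 1) (q_neq0 : q <> 0) (q_neq1 : q <> 1)
    (eq_nK0 : K0_class hp *+ n = K0_class hq *+ n)
    (neq_K0 : K0_class hp <> K0_class hq) :
  unitarily_equivalent (p%:M : 'M[A]_n) (q%:M : 'M[A]_n) /\
  ~ unitarily_equivalent p q.
Proof.
split; last first.
  move=> [u [u1 u2] upq]; apply: neq_K0.
  have [pp sp] := projP hp; have [qq sq] := projP hq.
  suff pq : cls hp = cls hq by rewrite -[LHS]mulr1n -[RHS]mulr1n !K0_class_muln pq.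
  (* For v = u^* p, v^* v = p and v v^* = u^* p u = q. *)
  apply: (@cls_eq _ _ _ (star u * p)); rewrite starM starK sp.
    by rewrite -mulrA [u * _]mulrA u2 mul1r.
  by rewrite -mulrA [p * (p * _)]mulrA pp mulrA.
have [z pqz] := MvN_of_K0_class eq_nK0.
have pq := cls_cancellation A_simple A_pi n_gt0 p_neq0 p_neq1 q_neq0 pqz.
have p1 : 1 - p <> 0 by move=> /eqP; rewrite subr_eq0 => /eqP/esym.
have p1' : 1 - p <> 1.
  by move=> /eqP; rewrite -subr_eq0 addrAC subrr sub0r oppr_eq0 => /eqP.
have q1 : 1 - q <> 0 by move=> /eqP; rewrite subr_eq0 => /eqP/esym.
(* Adding n[p] = n[q] turns both sides into n[1], and the common summand cancels. *)
have pq1 : cls (projection1B hp) *+ n = cls (projection1B hq) *+ n.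
  apply: (cls_cancellation A_simple A_pi (z := cls hp *+ n)) => //.
  by rewrite {2}pq addrC [RHS]addrC -!mulrnDl !cls_complement.
apply: (unitarily_equivalent_of_cls (hp := projection_scalar n hp)
  (hq := projection_scalar n hq)); first by rewrite !mxcls_scalar.
have E r (hr : projection r) :
    mxcls (mx_projection1B (projection_scalar n hr)) = cls (projection1B hr) *+ n.
  rewrite -(mxcls_scalar _ (projection_scalar n (projection1B hr))).
  by apply: mxcls_cong; rewrite raddfB.
by rewrite !E.
Qed.
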